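(* Let $\mathrm{L}$ be a Markov operator with invariant and reversible probability measure $\mu$, carré du champ $\Gamma$, and pure point spectrum $S=\{0=\lambda_0<\lambda_1<\lambda_2<\cdots\}$ (the spectrum of $-\mathrm{L}$). Let $k\ge1$, let $F$ be a $k$-chaos with eigenvalue $\lambda_k$, that is, $-\mathrm{L}F=\lambda_kF$ and $Q_{k+1}(\Gamma)(F)=0$ $\mu$-almost everywhere, and suppose that $\int_E F^2\,d\mu=p>0$. Write $\Gamma(F)=\Gamma(F,F)$. Assume that $$(-1)^k\,T_{k+1}\!\left(-\frac{\lambda_n}{2}\right)\le0\qquad\text{for every } n\in\mathbb N.$$ Then $$\operatorname{Var}_\mu\big(\Gamma(F)-\lambda_kF\big)\le\lambda_k\int_E F^2\,\Gamma(F)\,d\mu+A_k\int_E F\,\Gamma(F)\,d\mu-p\,B_k-p^2\lambda_k^2,$$ where $$A_k=\frac{2(-1)^k\lambda_k}{\pi_{k-1}}\,R_{k+1}\!\left(\frac{\lambda_k}{2}\right)\quad\text{and}\quad B_k=\frac{(-1)^k\lambda_k^2}{\pi_{k-1}}\,R_{k+1}\!\left(\frac{\lambda_k}{2}\right).$$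
   Context: Setting. $(E,\mathcal F,\mu)$ is a probability space; $\mathrm{L}$ is a Markov operator (the generator of a symmetric Markov semigroup, not necessarily a diffusion) acting on a suitable algebra $\mathcal A$ of real functions on $E$, with $\mathrm{L}1=0$, and $\mu$ is invariant and reversible: $\int_E f\,\mathrm{L}g\,d\mu=\int_E g\,\mathrm{L}f\,d\mu$. The carré du champ is $\Gamma(f,g)=\frac12[\mathrm{L}(fg)-f\mathrm{L}g-g\mathrm{L}f]$, $\Gamma(f)=\Gamma(f,f)\ge 0$; thus $\int_E f(-\mathrm{L}g)\,d\mu=\int_E\Gamma(f,g)\,d\mu$. $\mathrm{L}$ has pure point spectrum: $-\mathrm{L}$ has a countable sequence of eigenvalues $S=\{0=\lambda_0<\lambda_1<\lambda_2<\cdots\}$ and $L^2(\mu)$ is the orthogonal direct sum of the corresponding eigenspaces; $\mathrm{L}$ is ergodic ($\Gamma(f)=0$ implies $f$ constant $\mu$-a.e.). $\operatorname{Var}_\mu(f)=\int_E f^2d\mu-(\int_E f\,d\mu)^2$. Standing assumption: eigenfunctions are assumed to satisfy all domain and integrability conditions needed for the quantities and identities involved (integration by parts/symmetry of $\mathrm{L}$, and the iterated gradients) to make sense and be valid. Iterated gradients: $\Gamma_0(f,g)=fg$, $\Gamma_1=\Gamma$, and for $m\ge2$, $\Gamma_m(f,g)=\frac12[\mathrm{L}\Gamma_{m-1}(f,g)-\Gamma_{m-1}(f,\mathrm{L}g)-\Gamma_{m-1}(g,\mathrm{L}f)]$; $\Gamma_m(f)=\Gamma_m(f,f)$. Polynomials: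 for $k\ge1$, $Q_k(X)=\prod_{i=0}^{k-1}(X-\lambda_i)=\sum_{i=1}^k\frac1{i!}Q_k^{(i)}(0)X^i$, and $Q_k(\Gamma)=\sum_{i=1}^k\frac1{i!}Q_k^{(i)}(0)\,\Gamma_i$ (bilinear form), with $Q_k(\Gamma)(F)$ meaning $Q_k(\Gamma)(F,F)$. For $k\ge1$, $$R_{k+1}(X)=\frac1{X^2}\big[Q_{k+1}(X)-Q_{k+1}^{(1)}(0)X\big]=\sum_{i=2}^{k+1}\frac1{i!}Q_{k+1}^{(i)}(0)X^{i-2},\qquad T_{k+1}(X)=R_{k+1}(X+\lambda_k)-R_{k+1}(\lambda_k).$$ $\pi_k=\lambda_1\cdots\lambda_k$ for $k\ge1$, $\pi_0=1$. *)

(* Defs.v *)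
From HB Require Import structures.
From mathcomp Require Export all_boot all_order all_algebra.
From mathcomp Require Export all_classical all_reals all_analysis.
Set Implicit Arguments.
Unset Strict Implicit.
Unset Printing Implicit Defensive.
Import Order.TTheory GRing.Theory Num.Theory.
Import numFieldNormedType.Exports.
Local Open Scope classical_set_scope.
Local Open Scope ring_scope.

(* Elements of L^2(mu) are handled through representatives E -> R. Operators
   act on representatives, and identities between them hold mu-a.e. *)

Section Operators.
Context {R : realType} {d : measure_display} {E : measurableType d}.
Variable mu : probability E R.
Implicit Types (f g h F : E -> R) (A D : set (E -> R)).
Implicit Types (P : R -> (E -> R) -> E -> R) (L : (E -> R) -> E -> R).
Implicit Types (lam : nat -> R).

Definition L2 : set (E -> R) := [set f | f \in Lfun mu 2%:E].

Definition L2_cvg {I : Type} (X : set_system I) (u : I -> E -> R) f : Prop :=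
  'N[mu]_2%:E[EFin \o (u i - f)%R]%E @[i --> X] --> 0%E.

Record symmetric_Markov_semigroup P : Prop := {
  semigroup_L2 : forall t f, 0 <= t -> L2 f -> L2 (P t f);
  semigroup_linear : forall t (a b : R) f g, 0 <= t -> L2 f -> L2 g ->
    P t (cst a * f + cst b * g) = cst a * P t f + cst b * P t g %[ae mu];
  semigroup_positive : forall t f, 0 <= t -> L2 f ->
    (\forall x \ae mu, 0 <= f x) -> \forall x \ae mu, 0 <= P t f x;
  semigroup_unit : forall t, 0 <= t -> P t (cst 1) = cst 1 %[ae mu];
  semigroup_zero : forall f, L2 f -> P 0 f = f %[ae mu];
  semigroup_add : forall s t f, 0 <= s -> 0 <= t -> L2 f ->
    P (s + t) f = P s (P t f) %[ae mu];
  semigroup_symmetric : forall t f g, 0 <= t -> L2 f -> L2 g ->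
    (\int[mu]_x (f x * P t g x) = \int[mu]_x (g x * P t f x))%R;
  semigroup_continuous : forall f, L2 f -> L2_cvg 0^'+ (fun t => P t f) f
}.

(* g is the L^2-derivative of t |-> P t f at 0. *)
Definition generates P f g : Prop :=
  [/\ L2 f, L2 g & L2_cvg 0^'+ (fun t => cst t^-1 * (P t f - f)) g].

Definition Markov_operator D L : Prop :=
  exists P, [/\ symmetric_Markov_semigroup P,
    D = [set f | exists g, generates P f g] &
    forall f, D f -> generates P f (L f)].

Definition invariant D L : Prop := forall f, D f -> (\int[mu]_x L f x = 0)%R.

Definition reversible D L : Prop := forall f g, D f -> D g ->
  (\int[mu]_x (f x * L g x) = \int[mu]_x (g x * L f x))%R.

(* Gamma_1 is obtained from Gamma_0(f, g) = f g by the same recursion as the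
   higher gradients. *)
Fixpoint iter_grad L (m : nat) f g : E -> R :=
  match m with
  | 0 => f * g
  | m'.+1 => cst 2^-1 *
      (L (iter_grad L m' f g) - iter_grad L m' f (L g) - iter_grad L m' g (L f))
  end.

Definition carre_du_champ L f g : E -> R :=
  cst 2^-1 * (L (f * g) - f * L g - g * L f).

Lemma iter_grad1 L : iter_grad L 1 = carre_du_champ L.
Proof. by []. Qed.

(* Stability under products and inclusion in L^2 put all elements of A in every
   L^p, p finite. *)
Record carre_du_champ_algebra D L A : Prop := {
  algebra_domain : A `<=` D;
  algebra_cst : forall c : R, A (cst c);
  algebra_add : forall f g, A f -> A g -> A (f + g);
  algebra_mul : forall f g, A f -> A g -> A (f * g);
  algebra_stable : forall f, A f -> A (L f);
  algebra_L_cst1 : L (cst 1) = cst 0 %[ae mu];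
  algebra_Gamma_ge0 : forall f, A f ->
    \forall x \ae mu, 0 <= carre_du_champ L f f x
}.

Definition ergodic L A : Prop := forall f, A f ->
  carre_du_champ L f f = cst 0 %[ae mu] -> exists c : R, f = cst c %[ae mu].

Definition eigenspace D L (l : R) : set (E -> R) :=
  [set f | D f /\ - L f = cst l * f %[ae mu]].

Record pure_point_spectrum D L lam : Prop := {
  spectrum0 : lam 0%N = 0;
  spectrum_increasing : {homo lam : m n / (m < n)%N >-> m < n};
  spectrum_eigenvalue : forall n,
    exists2 f, eigenspace D L (lam n) f & ~ (f = cst 0 %[ae mu]);
  spectrum_orthogonal : forall m n f g, m <> n ->
    eigenspace D L (lam m) f -> eigenspace D L (lam n) g ->
    (\int[mu]_x (f x * g x) = 0)%R;
  spectrum_total : forall f, L2 f -> exists2 u : nat -> E -> R,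
    forall n, eigenspace D L (lam n) (u n) &
    L2_cvg \oo (fun N => \sum_(n < N) u n) f
}.

Definition Qpoly lam (k : nat) : {poly R} := \prod_(i < k) ('X - (lam i)%:P).

Definition Qcoef lam (k i : nat) : R := (i`!%:R)^-1 * (Qpoly lam k)^`(i).[0].

Definition Qgrad lam L (k : nat) f g : E -> R :=
  \sum_(1 <= i < k.+1) cst (Qcoef lam k i) * iter_grad L i f g.

(* Rpoly lam k.+1 and Tpoly lam k.+1 are R_{k+1} and T_{k+1}: the index is the
   degree of the underlying Q, and the shift in T is by the last root of Q. *)
Definition Rpoly lam (m : nat) : {poly R} :=
  \sum_(2 <= i < m.+1) Qcoef lam m i *: 'X^(i - 2).

Definition Tpoly lam (m : nat) : {poly R} :=
  Rpoly lam m \Po ('X + (lam m.-1)%:P) - ((Rpoly lam m).[lam m.-1])%:P.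

Definition eig_prod lam (k : nat) : R := \prod_(1 <= i < k.+1) lam i.

Definition chaos L lam (k : nat) F : Prop :=
  - L F = cst (lam k) * F %[ae mu] /\ Qgrad lam L k.+1 F F = cst 0 %[ae mu].

Definition Acoef lam (k : nat) : R :=
  2 * (-1) ^+ k * lam k / eig_prod lam k.-1 * (Rpoly lam k.+1).[lam k / 2].

Definition Bcoef lam (k : nat) : R :=
  (-1) ^+ k * lam k ^+ 2 / eig_prod lam k.-1 * (Rpoly lam k.+1).[lam k / 2].

End Operators.

(* Main.v *)
Require Import Defs.
From mathcomp Require Import ring lra.
Import Order.TTheory GRing.Theory Num.Theory.
Import numFieldNormedType.Exports.
Local Open Scope classical_set_scope.
Local Open Scope ring_scope.

(** Everything is read on coefficients against eigenfunctions. Write [l] for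
[lam k], [G] for [Gamma(F)], [pi] for [eig_prod lam k.-1], and
[T n = (-1)^k T_{k+1}(- lam n / 2)].

Since [L F = - l F], the recursion for the gradients collapses on the diagonal
to [Gamma_{m+1}(F) = (L/2 + l) Gamma_m(F)], so that [Gamma_m(F)] has coefficient
[(l - lam n / 2)^m <u, F^2>] on any [u] in the [n]-th eigenspace
([eigen_coef_iter_grad]). The chaos condition then says that
[Q_{k+1}(l - lam n / 2) <u, F^2> = 0]. Writing [Q_{k+1}] in terms of [R_{k+1}],
and using [Q_{k+1}(l) = 0] to evaluate [R_{k+1}(l)], this turns into
[T n <u, G> = pi <u, L(F^2)/2>], as long as [l - lam n / 2 <> 0]
([Tpoly_coef_carre]).

The sign hypothesis is applied to [G - l F] rather than to [G] alone, which is
what produces the terms [A_k] and [B_k]. With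
[H = pi L(F^2)/2 - l (T k) F], one has [<u, H> = (T n) <u, G - l F>] on the [n]-th
eigenspace, hence [<G - l F, H> <= 0] by summing over the spectral decomposition
of [G - l F]. The one possible exceptional index, [lam n = 2 l], is harmless: the
component of [G - l F] there is zero. Since [L(F^2)/2 = G - l F^2], expanding
[<G - l F, H> <= 0] bounds [<G, G>] ([chaos_dissipation]); the first moments of
[G] and [F] are [l p] and [0], and [1 + c = T k / pi] for
[c = (-1)^k R_{k+1}(l/2) / pi], [A_k = 2 l c], [B_k = l^2 c], which is the
announced variance bound.

The spectral decomposition also takes the place of any linearity of [L]: a
square-integrable function with zero coefficient on every eigenfunction
vanishes almost everywhere, and reversibility determines the coefficients of
[L f] from those of [f]. *)

(** * The inner product of square-integrable functions *)

Section InnerProduct.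
Set Implicit Arguments.
Unset Strict Implicit.
Unset Printing Implicit Defensive.
Context {R : realType} {d : measure_display} {E : measurableType d}.
Variable mu : probability E R.
Implicit Types f g h : E -> R.

Definition dotL2 f g : R := \int[mu]_x (f x * g x).

Lemma L2_measurable f : L2 mu f -> measurable_fun [set: E] f.
Proof. by rewrite /L2 /= inE => /andP[]; rewrite inE. Qed.

Lemma L2_Lnorm f : L2 mu f -> ('N[mu]_2%:E[EFin \o f] < +oo)%E.
Proof. by rewrite /L2 /= inE => /andP[_]; rewrite inE. Qed.

Lemma L2_add f g : L2 mu f -> L2 mu g -> L2 mu (f + g).
Proof. by move=> f2 g2; have [_] := Lfun_addr_closed mu (lee1n 2); apply. Qed.

Lemma L2_scale (c : R) f : L2 mu f -> L2 mu (cst c * f).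
Proof.
move=> f2; rewrite (_ : cst c * f = c \o* f); last first.
  by apply/funext => x /=; rewrite mulrC.
by apply: Lfun_scale; rewrite ?ler1n.
Qed.

Lemma L2_opp f : L2 mu f -> L2 mu (- f).
Proof. by rewrite -mulN1r => /(L2_scale (-1)). Qed.

Lemma L2_sub f g : L2 mu f -> L2 mu g -> L2 mu (f - g).
Proof. by move=> f2 /L2_opp; exact: L2_add. Qed.

Lemma L2_cst (c : R) : L2 mu (cst c).
Proof. exact: Lfun_cst. Qed.

Lemma L2_sum I (r : seq I) (u : I -> E -> R) :
  (forall i, L2 mu (u i)) -> L2 mu (\sum_(i <- r) u i).
Proof.
move=> u2; elim: r => [|i r IH]; first by rewrite big_nil; exact: L2_cst.
by rewrite big_cons; exact: L2_add.
Qed.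

Lemma L2_mul_integrable f g : L2 mu f -> L2 mu g ->
  mu.-integrable setT (EFin \o (fun x => f x * g x)).
Proof. by move=> f2 g2; apply/Lfun1_integrable/Lfun2_mul_Lfun1. Qed.

Lemma dotL2C f g : dotL2 f g = dotL2 g f.
Proof. by apply: eq_Rintegral => x _; rewrite mulrC. Qed.

Lemma dotL2Dl f g h : L2 mu f -> L2 mu g -> L2 mu h ->
  dotL2 (f + g) h = dotL2 f h + dotL2 g h.
Proof.
move=> f2 g2 h2; rewrite /dotL2 -RintegralD//; try exact: L2_mul_integrable.
by apply: eq_Rintegral => x _; rewrite /= mulrDl.
Qed.

Lemma dotL2Zl (c : R) f h : L2 mu f -> L2 mu h ->
  dotL2 (cst c * f) h = c * dotL2 f h.
Proof.
move=> f2 h2; rewrite /dotL2 -RintegralZl//; last exact: L2_mul_integrable.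
by apply: eq_Rintegral => x _; rewrite /= mulrA.
Qed.

Lemma dotL2Nl f h : L2 mu f -> L2 mu h -> dotL2 (- f) h = - dotL2 f h.
Proof.
move=> f2 h2; rewrite -[RHS]mulN1r -dotL2Zl//.
by apply: eq_Rintegral => x _; rewrite /= mulN1r.
Qed.

Lemma dotL2Bl f g h : L2 mu f -> L2 mu g -> L2 mu h ->
  dotL2 (f - g) h = dotL2 f h - dotL2 g h.
Proof. by move=> f2 g2 h2; rewrite dotL2Dl ?dotL2Nl//; exact: L2_opp. Qed.

Lemma dotL2_0l h : L2 mu h -> dotL2 (cst 0) h = 0.
Proof.
move=> h2; rewrite -[RHS](mul0r (dotL2 h h)) -dotL2Zl//.
by apply: eq_Rintegral => x _; rewrite /= !mul0r.
Qed.

Lemma dotL2_suml I (r : seq I) (u : I -> E -> R) h :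
    (forall i, L2 mu (u i)) -> L2 mu h ->
  dotL2 (\sum_(i <- r) u i) h = \sum_(i <- r) dotL2 (u i) h.
Proof.
move=> u2 h2; elim: r => [|i r IH]; first by rewrite !big_nil; exact: dotL2_0l.
by rewrite !big_cons dotL2Dl ?IH//; exact: L2_sum.
Qed.

Lemma eq_ae_dotL2 f g h : L2 mu f -> L2 mu g -> L2 mu h ->
  f = g %[ae mu] -> dotL2 f h = dotL2 g h.
Proof.
move=> f2 g2 h2 fg; congr fine; apply: ae_eq_integral => //.
- by have /measurable_int := L2_mul_integrable f2 h2.
- by have /measurable_int := L2_mul_integrable g2 h2.
by apply: filterS fg => x fg /fg ->.
Qed.

Lemma dotL2_eq0 f : L2 mu f -> dotL2 f f = 0 -> f = cst 0 %[ae mu].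
Proof.
move=> f2 ff0; have ff1 := L2_mul_integrable f2 f2.
have : (\int[mu]_x `|(f x * f x)%:E| = 0)%E.
  rewrite -[RHS]/(0%R%:E) -ff0 /dotL2 /Rintegral fineK; last first.
    exact: integrable_fin_num.
  by apply: eq_integral => x _; rewrite gee0_abs// lee_fin -expr2 sqr_ge0.
move/(ae_eq_integral_abs mu measurableT (measurable_int _ ff1)).
apply: filterS => x /[apply] /= -[/eqP]; rewrite mulf_eq0 orbb.
by move/eqP.
Qed.

Lemma dotL2_ge0 f : 0 <= dotL2 f f.
Proof. by apply: Rintegral_ge0 => x _; rewrite -expr2 sqr_ge0. Qed.

Lemma cauchy_schwarz f g : L2 mu f -> L2 mu g ->
  (`|dotL2 f g|%:E <= 'N[mu]_2%:E[EFin \o f] * 'N[mu]_2%:E[EFin \o g])%E.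
Proof.
move=> f2 g2; have fg1 := L2_mul_integrable f2 g2.
rewrite EFin_normr_Rintegral//.
apply: (le_trans (le_abse_integral _ measurableT (measurable_int _ fg1))).
have := @hoelder _ _ _ mu f g 2 2 (L2_measurable f2) (L2_measurable g2).
rewrite Lnorm1; apply=> //; by rewrite [RHS]splitr !div1r.
Qed.

(** Cauchy-Schwarz against the fixed function [h]. *)
Lemma dotL2_cvg (u : nat -> E -> R) f h :
  (forall n, L2 mu (u n)) -> L2 mu f -> L2 mu h ->
  L2_cvg mu \oo u f -> dotL2 (u n) h @[n --> \oo] --> dotL2 f h.
Proof.
move=> u2 f2 h2 uf.
have h_fin : ('N[mu]_2%:E[EFin \o h] \is a fin_num)%E.
  by rewrite ge0_fin_numE ?Lnorm_ge0//; exact: L2_Lnorm.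
have normP : ('N[mu]_2%:E[EFin \o (u n - f)%R] * 'N[mu]_2%:E[EFin \o h])%E
    @[n --> \oo] --> 0%E.
  rewrite -(mul0e 'N[mu]_2%:E[EFin \o h]%E) -(fineK h_fin).
  exact: cvgeZr.
apply/cvgrPdist_le => e e0.
move/fine_cvgP : normP => [fin_n /cvgr0_norm_le /(_ e e0)].
apply: filterS2 fin_n => n fin_n; apply: le_trans.
have un2 := L2_sub (u2 n) f2.
rewrite distrC -dotL2Bl// -lee_fin; apply: (le_trans (cauchy_schwarz un2 h2)).
by rewrite -(fineK fin_n) lee_fin ler_norm.
Qed.

End InnerProduct.

(** * Algebra of the polynomials Q, R and T *)

Section Polynomials.
Set Implicit Arguments.
Unset Strict Implicit.
Unset Printing Implicit Defensive.
Context {R : realType}.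
Variable lam : nat -> R.
Hypothesis lam0 : lam 0 = 0.

Lemma QcoefE m i : Qcoef lam m i = (Qpoly lam m)`_i.
Proof.
rewrite /Qcoef horner_coef0 coef_derivn addn0 ffactnn.
by rewrite -[X in _ * X]mulr_natl mulrA mulVf ?mul1r.
Qed.

Lemma size_Qpoly m : size (Qpoly lam m) = m.+1.
Proof. by rewrite /Qpoly size_prod_XsubC /index_enum -enumT size_enum_ord. Qed.

Lemma Qpoly_root m i : (i < m)%N -> (Qpoly lam m).[lam i] = 0.
Proof.
move=> im; rewrite /Qpoly horner_prod (bigD1 (Ordinal im))//=.
by rewrite !hornerE subrr mul0r.
Qed.

Lemma Qcoef0 k : Qcoef lam k.+1 0 = 0.
Proof. by rewrite QcoefE -horner_coef0 -[X in _.[X]]lam0 Qpoly_root. Qed.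

Lemma Qcoef1 k : Qcoef lam k.+1 1 = (-1) ^+ k * eig_prod lam k.
Proof.
rewrite QcoefE /Qpoly big_ord_recl lam0 subr0 coefXM/= -horner_coef0 horner_prod.
rewrite /eig_prod big_add1/= big_mkord -[X in (-1) ^+ X]card_ord -prodrN.
by apply: eq_bigr => i _; rewrite !hornerE.
Qed.

Lemma horner_Qpoly m x :
  (Qpoly lam m.+1).[x] = \sum_(1 <= i < m.+2) Qcoef lam m.+1 i * x ^+ i.
Proof.
rewrite horner_coef size_Qpoly -(big_mkord xpredT (fun i => _`_i * x ^+ i)).
rewrite big_nat_recl// -QcoefE Qcoef0 mul0r add0r big_add1/=.
by apply: eq_bigr => i _; rewrite QcoefE.
Qed.

Lemma Qpoly_Rpoly k x :
  (Qpoly lam k.+1).[x] = x * ((-1) ^+ k * eig_prod lam k + x * (Rpoly lam k.+1).[x]).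
Proof.
rewrite horner_Qpoly big_nat_recl// expr1 Qcoef1 /Rpoly horner_sum mulrDr mulrC.
congr (_ + _).
rewrite [in RHS]big_add1/= !mulr_sumr; apply: eq_big_nat => -[|i] // _.
by rewrite hornerZ hornerXn subSS subSS subn0 2!exprS; ring.
Qed.

(** Forced by [lam k] being a root of [Qpoly lam k.+1]. *)
Lemma Rpoly_at_eig k : (0 < k)%N -> lam k != 0 ->
  (Rpoly lam k.+1).[lam k] = - ((-1) ^+ k * eig_prod lam k.-1).
Proof.
case: k => // k _ lamk0; have := Qpoly_Rpoly k.+1 (lam k.+1).
rewrite Qpoly_root// => /esym/eqP; rewrite mulf_eq0 (negbTE lamk0)/= addr_eq0.
rewrite {1}/eig_prod big_nat_recr//= mulrA => /eqP h.
apply: (mulfI lamk0); rewrite mulrN [X in - X]mulrC /eig_prod.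
by rewrite h opprK.
Qed.

Lemma horner_Tpoly k x :
  (Tpoly lam k.+1).[x] = (Rpoly lam k.+1).[x + lam k] - (Rpoly lam k.+1).[lam k].
Proof. by rewrite /Tpoly /= !hornerE horner_comp !hornerE. Qed.

(** The chaos equation on one spectral component. Here [a] is the coefficient of
[F^2] and [t = - lam n / 2]. Dividing the equation by [lam k + t] leaves
[(-1)^k pi_k a + (lam k + t) R(lam k + t) a = 0], and the value of [R] at [lam k]
cancels the constant part of this relation, so that only [t] survives. *)
Lemma Tpoly_chaos k t a : (0 < k)%N -> lam k != 0 -> lam k + t != 0 ->
  (Qpoly lam k.+1).[lam k + t] * a = 0 ->
  (-1) ^+ k * (Tpoly lam k.+1).[t] * ((lam k + t) * a) = eig_prod lam k.-1 * (t * a).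
Proof.
move=> k0 lamk0 x0 /eqP; rewrite Qpoly_Rpoly -mulrA mulf_eq0 (negbTE x0)/=.
rewrite mulrDl addrC addr_eq0 => /eqP Rxa.
rewrite horner_Tpoly [t + _]addrC Rpoly_at_eig//.
set x := lam k + t in x0 Rxa *.
have eig_prodk : eig_prod lam k = eig_prod lam k.-1 * lam k.
  by case: k k0 {lamk0 Rxa x x0} => // k _; rewrite /eig_prod big_nat_recr.
have -> : (-1) ^+ k * ((Rpoly lam k.+1).[x] - - ((-1) ^+ k * eig_prod lam k.-1)) * (x * a)
  = (-1) ^+ k * (x * (Rpoly lam k.+1).[x] * a) +
    ((-1) ^+ k * (-1) ^+ k) * (eig_prod lam k.-1 * (x * a)) by ring.
rewrite Rxa eig_prodk mulrN !mulrA -!expr2 sqrr_sign.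
by rewrite /x; ring.
Qed.

End Polynomials.

(** * Spectral coefficients of the operator and of the iterated gradients *)

Section Spectral.
Set Implicit Arguments.
Unset Strict Implicit.
Unset Printing Implicit Defensive.
Context {R : realType} {d : measure_display} {E : measurableType d}.
Variables (mu : probability E R) (D : set (E -> R)) (L : (E -> R) -> E -> R).
Variable lam : nat -> R.
Hypothesis HL : Markov_operator mu D L.
Hypothesis Hrev : reversible mu D L.
Hypothesis Hspec : pure_point_spectrum mu D L lam.
Implicit Types f g h u w : E -> R.

Lemma domain_L2 f : D f -> L2 mu f.
Proof. by case: HL => P [_ _ gen] /gen[]. Qed.

Lemma operator_L2 f : D f -> L2 mu (L f).
Proof. by case: HL => P [_ _ gen] /gen[]. Qed.

Lemma eigen_L2 l u : eigenspace mu D L l u -> L2 mu u.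
Proof. by case=> /domain_L2. Qed.

Lemma eigen_coef_operator l u f : eigenspace mu D L l u -> D f ->
  dotL2 mu u (L f) = - l * dotL2 mu u f.
Proof.
move=> [Du Lu] Df; rewrite /dotL2 (Hrev Du Df) -/(dotL2 mu f (L u)) dotL2C.
have [u2 f2] := (domain_L2 Du, domain_L2 Df).
rewrite -dotL2Zl//; apply: eq_ae_dotL2 => //.
- exact: operator_L2.
- exact: L2_scale.
apply: filterS Lu => x /[apply] Lu; apply: oppr_inj.
by rewrite /= mulNr opprK; exact: Lu.
Qed.

Lemma eigen_coef_distinct m n u v : lam m != lam n ->
  eigenspace mu D L (lam m) u -> eigenspace mu D L (lam n) v ->
  dotL2 mu u v = 0.
Proof.
move=> mn eu ev; apply: (spectrum_orthogonal Hspec) eu ev.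
by move=> /(congr1 lam)/eqP; rewrite (negbTE mn).
Qed.

(** The components [u n] are orthogonal, so pairing [f] with [u n] leaves only
the norm of [u n]. *)
Lemma eigen_expansion f : L2 mu f -> exists2 u : nat -> E -> R,
  forall n, eigenspace mu D L (lam n) (u n) /\
            dotL2 mu (u n) f = dotL2 mu (u n) (u n) &
  forall h, L2 mu h ->
    \sum_(n < N) dotL2 mu (u n) h @[N --> \oo] --> dotL2 mu f h.
Proof.
move=> f2; have [u eu uf] := spectrum_total Hspec f2.
have u2 n := eigen_L2 (eu n).
have cvg_u h : L2 mu h ->
    \sum_(n < N) dotL2 mu (u n) h @[N --> \oo] --> dotL2 mu f h.
  move=> h2; under eq_cvg do rewrite -dotL2_suml//.
  by apply: dotL2_cvg => // n; exact: L2_sum.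
exists u => // n; split => //.
have := cvg_u _ (u2 n); rewrite dotL2C => /(cvg_lim (@Rhausdorff R)) <-.
apply: (cvg_lim (@Rhausdorff R)); apply: cvg_near_cst.
exists n.+1 => // N /= nN.
rewrite (bigD1 (Ordinal nN))//= big1 ?addr0// => m mn.
apply: (spectrum_orthogonal Hspec) (eu m) (eu n).
by move=> mnE; move: mn; rewrite -val_eqE /= mnE eqxx.
Qed.

(** Only the components of [f] need to be tested, that is, the eigenfunctions
[u] with [<u, f> = <u, u>]. In particular a zero component of [f] puts no
constraint on [h]. *)
Lemma dotL2_le0_spectral f h : L2 mu f -> L2 mu h ->
  (forall n u, eigenspace mu D L (lam n) u ->
    dotL2 mu u f = dotL2 mu u u -> dotL2 mu u h <= 0) ->
  dotL2 mu f h <= 0.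
Proof.
move=> f2 h2 le0; have [u uP /(_ _ h2) uh] := eigen_expansion f2.
apply: (@cvgr_to_le _ _ _ _ _ _ _ uh).
by apply: nearW => N; apply: sumr_le0 => n _; have [eu uf] := uP n; exact: le0 eu uf.
Qed.

Lemma eigen_total w : L2 mu w ->
  (forall n u, eigenspace mu D L (lam n) u -> dotL2 mu u w = 0) ->
  w = cst 0 %[ae mu].
Proof.
move=> w2 w0; apply: dotL2_eq0 => //; apply/eqP; rewrite eq_le dotL2_ge0 andbT.
by apply: dotL2_le0_spectral => // n u eu _; rewrite (w0 n).
Qed.

(** [L] acts on representatives, but its value is determined almost everywhere
by its coefficients, and by symmetry these depend only on the class of the
argument, linearly. *)
Lemma operator_ae_scale (c : R) f g : D f -> D g ->
  g = cst c * f %[ae mu] -> L g = cst c * L f %[ae mu].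
Proof.
move=> Df Dg gf.
have [f2 g2] := (domain_L2 Df, domain_L2 Dg).
have [Lf2 Lg2] := (operator_L2 Df, operator_L2 Dg).
suff : L g - cst c * L f = cst 0 %[ae mu].
  by apply: filterS => x /[apply] /= e; apply/eqP; rewrite -subr_eq0; apply/eqP.
apply: eigen_total => [|n u eu]; first exact/L2_sub/L2_scale.
have u2 := eigen_L2 eu.
rewrite dotL2C dotL2Bl ?dotL2Zl//; last exact: L2_scale.
rewrite !(dotL2C _ (L _)) !(eigen_coef_operator eu)// (dotL2C _ _ g).
rewrite (eq_ae_dotL2 g2 (L2_scale c f2) u2 gf) dotL2Zl// (dotL2C _ f u).
by rewrite mulrCA subrr.
Qed.

Variable A : set (E -> R).
Hypothesis HA : carre_du_champ_algebra mu D L A.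

Lemma algebra_scale (c : R) f : A f -> A (cst c * f).
Proof. by move=> Af; apply: (algebra_mul HA) => //; exact: (algebra_cst HA). Qed.

Lemma algebra_sub f g : A f -> A g -> A (f - g).
Proof.
move=> Af Ag; apply: (algebra_add HA) => //; rewrite -mulN1r.
exact: (algebra_scale (-1)).
Qed.

Lemma algebra_iter_grad m f g : A f -> A g -> A (iter_grad L m f g).
Proof.
elim: m f g => [|m IH] f g Af Ag /=; first exact: (algebra_mul HA).
have AL := algebra_stable HA.
by apply: algebra_scale; do 2?apply: algebra_sub; auto.
Qed.

(** Scaling and invariance under almost everywhere equality are proved together:
[L F] is only almost everywhere a multiple of [F], and the gradients have to be
evaluated at [L F]. *)
Lemma iter_grad_ae_scale m (a b : R) f f' g g' : A f -> A f' -> A g -> A g' ->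
  f' = cst a * f %[ae mu] -> g' = cst b * g %[ae mu] ->
  iter_grad L m f' g' = cst (a * b) * iter_grad L m f g %[ae mu].
Proof.
elim: m a b f f' g g' => [|m IH] a b f f' g g' Af Af' Ag Ag' ff' gg'.
  apply: filterS2 ff' gg' => x /[swap] gg' /[swap] xT /(_ xT) ff'.
  move: (gg' xT) ff'; rewrite /iter_grad !fctE => -> ->; ring.
have AL := algebra_stable HA; have AD := algebra_domain HA.
have Lff' := operator_ae_scale (AD _ Af) (AD _ Af') ff'.
have Lgg' := operator_ae_scale (AD _ Ag) (AD _ Ag') gg'.
have h1 := operator_ae_scale (AD _ (algebra_iter_grad m Af Ag))
  (AD _ (algebra_iter_grad m Af' Ag')) (IH _ _ _ _ _ _ Af Af' Ag Ag' ff' gg').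
have h2 := IH _ _ _ _ _ _ Af Af' (AL _ Ag) (AL _ Ag') ff' Lgg'.
have h3 := IH _ _ _ _ _ _ Ag Ag' (AL _ Af) (AL _ Af') gg' Lff'.
apply: filterS3 h1 h2 h3 => x h1 h2 h3 _; move: (h1 I) (h2 I) (h3 I).
rewrite /= !fctE => -> -> ->; ring.
Qed.

Variables (F : E -> R) (l : R).
Hypothesis AF : A F.
Hypothesis LF : - L F = cst l * F %[ae mu].

Lemma iter_grad_eigen m :
  iter_grad L m.+1 F F =
    cst 2^-1 * L (iter_grad L m F F) + cst l * iter_grad L m F F %[ae mu].
Proof.
have LF' : L F = cst (- l) * F %[ae mu].
  apply: filterS LF => x /[apply] LFx; apply: oppr_inj.
  by rewrite /= mulNr opprK; exact: LFx.
have FF : F = cst 1 * F %[ae mu] by apply: aeW => x _; rewrite /= mul1r.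
have := iter_grad_ae_scale m AF AF AF (algebra_stable HA AF) FF LF'.
by apply: filterS => x h _; move: (h I); rewrite /= !fctE => ->; field.
Qed.

Lemma eigen_coef_iter_grad n u m : eigenspace mu D L n u ->
  dotL2 mu u (iter_grad L m F F) = (l - n / 2) ^+ m * dotL2 mu u (F * F).
Proof.
move=> eu; have u2 := eigen_L2 eu; elim: m => [|m IH]; first by rewrite mul1r.
have Dm m' : D (iter_grad L m' F F).
  exact/(algebra_domain HA)/algebra_iter_grad.
have G2 := domain_L2 (Dm m); have LG2 := operator_L2 (Dm m).
rewrite dotL2C (eq_ae_dotL2 (domain_L2 (Dm m.+1)) _ u2 (iter_grad_eigen m)); last first.
  by apply: L2_add; exact: L2_scale.
rewrite dotL2Dl ?dotL2Zl ?(dotL2C _ _ u)//; try exact: L2_scale.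
by rewrite (eigen_coef_operator eu)// IH exprS; field.
Qed.

End Spectral.

(** * The dissipation inequality for a chaos *)

Section Chaos.
Set Implicit Arguments.
Unset Strict Implicit.
Unset Printing Implicit Defensive.
Context {R : realType} {d : measure_display} {E : measurableType d}.
Variables (mu : probability E R) (D : set (E -> R)) (L : (E -> R) -> E -> R).
Variables (A : set (E -> R)) (lam : nat -> R).
Hypothesis HL : Markov_operator mu D L.
Hypothesis Hrev : reversible mu D L.
Hypothesis HA : carre_du_champ_algebra mu D L A.
Hypothesis Hspec : pure_point_spectrum mu D L lam.
Variables (k : nat) (F : E -> R).
Hypotheses (k_gt0 : (0 < k)%N) (AF : A F) (HF : chaos mu L lam k F).
Hypothesis HT : forall n : nat, (-1) ^+ k * (Tpoly lam k.+1).[- (lam n / 2)] <= 0.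

Local Notation l := (lam k).
Local Notation G := (carre_du_champ L F F).
Local Notation dot := (dotL2 mu).
Local Notation T n := ((-1) ^+ k * (Tpoly lam k.+1).[- (lam n / 2)]).

Lemma lam_gt0 n : (0 < n)%N -> 0 < lam n.
Proof. by move=> n0; rewrite -(spectrum0 Hspec); exact: (spectrum_increasing Hspec). Qed.

Lemma eig_prod_gt0 n : 0 < eig_prod lam n.
Proof.
by rewrite /eig_prod big_add1 big_mkord; apply: prodr_gt0 => i _; exact: lam_gt0.
Qed.

Let AL2 f : A f -> L2 mu f.
Proof. by move=> /(algebra_domain HA); exact: (domain_L2 HL). Qed.

Lemma eigen_coef_Qgrad n u : eigenspace mu D L (lam n) u ->
  dot u (Qgrad lam L k.+1 F F) = (Qpoly lam k.+1).[l - lam n / 2] * dot u (F * F).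
Proof.
move=> eu; have u2 := eigen_L2 HL eu.
have G2 m : L2 mu (iter_grad L m F F) by apply/AL2/(algebra_iter_grad HA).
rewrite (horner_Qpoly (spectrum0 Hspec)) /Qgrad mulr_suml.
rewrite dotL2C dotL2_suml//; last by move=> i; exact: L2_scale.
apply: eq_bigr => i _; rewrite dotL2Zl// dotL2C.
by rewrite (eigen_coef_iter_grad HL Hrev Hspec HA AF HF.1 _ eu) mulrA.
Qed.

Let eigF : eigenspace mu D L l F.
Proof. by split; [exact: (algebra_domain HA)|exact: HF.1]. Qed.

Let LFF2 : L2 mu (cst 2^-1 * L (F * F)).
Proof. by apply/L2_scale/AL2/(algebra_stable HA)/(algebra_mul HA). Qed.

Let G2 : L2 mu G.
Proof. by apply/AL2/(algebra_iter_grad HA 1). Qed.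

Let F2 : L2 mu F. Proof. exact: AL2. Qed.

Let FF2 : L2 mu (F * F). Proof. by apply/AL2/(algebra_mul HA). Qed.

(** Formally [(-1)^k T(L/2) G = pi L(F^2)/2] away from the kernel of [L/2 + l].
On that kernel the coefficient of [G] vanishes but that of [L(F^2)] need not,
whence the restriction. *)
Lemma Tpoly_coef_carre n u : eigenspace mu D L (lam n) u -> l - lam n / 2 != 0 ->
  T n * dot u G = eig_prod lam k.-1 * dot u (cst 2^-1 * L (F * F)).
Proof.
move=> eu x0; have u2 := eigen_L2 HL eu.
have := eigen_coef_Qgrad eu; rewrite dotL2C.
have Q2 : L2 mu (Qgrad lam L k.+1 F F).
  apply: L2_sum => i.
  by apply/L2_scale/AL2/(algebra_iter_grad HA).
rewrite (eq_ae_dotL2 Q2 (L2_cst mu 0) u2 HF.2) dotL2_0l// => /esym Q0.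
have [l0 AFF] := (lt0r_neq0 (lam_gt0 k_gt0), algebra_mul HA AF AF).
rewrite (eigen_coef_iter_grad HL Hrev Hspec HA AF HF.1 1 eu) expr1.
rewrite (Tpoly_chaos (spectrum0 Hspec) k_gt0 l0 x0 Q0).
rewrite (dotL2C _ u (cst _ * _)) dotL2Zl// ?(dotL2C _ _ u); last first.
  exact/AL2/(algebra_stable HA).
rewrite (eigen_coef_operator HL Hrev eu); last exact: (algebra_domain HA).
by field.
Qed.

(** This is the inequality [<G - l F, (-1)^k T(L/2) (G - l F)> <= 0], with
[(-1)^k T(L/2) (G - l F)] replaced by the function [H] that has the same
coefficients on all components of [G - l F]. Since [F] itself is an eigenfunction
with [l - l / 2 <> 0], both mixed terms equal
[l (T k) <F, G>]. *)
Lemma chaos_dissipation :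
  dot G G <= l * dot (F * F) G +
    (T k / eig_prod lam k.-1) * (2 * l * dot F G - l ^+ 2 * dot F F).
Proof.
set G := carre_du_champ L F F; have G2' : L2 mu G := G2.
set pk := eig_prod lam k.-1; set t := T k.
have l0 := lam_gt0 k_gt0; have pk0 : 0 < pk := eig_prod_gt0 _.
have DF := algebra_domain HA AF.
have lx : l - l / 2 != 0 by rewrite lt0r_neq0//; lra.
pose H := cst pk * (cst 2^-1 * L (F * F)) - cst (l * t) * F.
have GF2 : L2 mu (G - cst l * F) by exact/L2_sub/L2_scale.
have H2 : L2 mu H by apply: L2_sub; exact: L2_scale.
have coefH u : L2 mu u ->
    dot u H = pk * dot u (cst 2^-1 * L (F * F)) - l * t * dot u F.
  move=> u2; rewrite dotL2C dotL2Bl//; try exact: L2_scale.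
  by rewrite (dotL2Zl pk)// (dotL2Zl (l * t))// 2!(dotL2C _ _ u).
have coefG u : L2 mu u -> dot u (G - cst l * F) = dot u G - l * dot u F.
  move=> u2; rewrite dotL2C dotL2Bl//; last exact: L2_scale.
  by rewrite dotL2Zl// 2!(dotL2C _ _ u).
have GH : dot (G - cst l * F) H <= 0.
  apply: (dotL2_le0_spectral HL Hspec) => // n u eu uG.
  have u2 := eigen_L2 HL eu.
  (* For lam n = 2 l the component u is zero: G and F have coefficient 0 on it. *)
  have [x0|x0] := eqVneq (l - lam n / 2) 0.
    have uF : dot u F = 0.
      apply: (eigen_coef_distinct Hspec _ eu eigF).
      by apply/eqP => ln; move: lx; rewrite -[X in _ - X / _]ln x0 eqxx.
    move: uG; rewrite coefG// uF (eigen_coef_iter_grad HL Hrev Hspec HA AF HF.1 1 eu).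
    rewrite expr1 x0 mul0r mulr0 subr0 => /esym /(dotL2_eq0 u2) u0.
    by rewrite (eq_ae_dotL2 u2 (L2_cst mu 0) H2 u0) dotL2_0l.
  have tuF : t * dot u F = T n * dot u F.
    have [->//|nk] := eqVneq (lam n) l.
    by rewrite (eigen_coef_distinct Hspec nk eu eigF) !mulr0.
  have -> : dot u H = T n * dot u u.
    by rewrite -uG coefG// coefH// -(Tpoly_coef_carre eu x0) -(mulrA l t) tuF; ring.
  by rewrite mulr_le0_ge0// dotL2_ge0.
move: GH; rewrite dotL2Bl//; last exact: L2_scale.
rewrite dotL2Zl// !coefH//.
rewrite -(Tpoly_coef_carre eigF lx) -/t -/G.
have -> : dot G (cst 2^-1 * L (F * F)) = dot G G - l * dot (F * F) G.
  have Gae : cst 2^-1 * L (F * F) = G - cst l * (F * F) %[ae mu].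
    have : G = cst 2^-1 * L (F * F) + cst l * (F * F) %[ae mu].
      exact: (iter_grad_eigen HL Hrev Hspec HA AF HF.1 0).
    apply: filterS => x /[apply] Gx.
    by rewrite -[RHS]/(G x - (cst l * (F * F)) x) Gx; exact/esym/addrK.
  rewrite dotL2C (eq_ae_dotL2 _ _ G2 Gae)//; last first.
    by apply: L2_sub => //; exact: L2_scale.
  by rewrite dotL2Bl// ?(dotL2Zl l)//; exact: L2_scale.
rewrite (dotL2C _ G F) => GH.
rewrite -lerBlDl -(ler_pM2l pk0).
have -> : pk * (t / pk * (2 * l * dot F G - l ^+ 2 * dot F F)) =
    t * (2 * l * dot F G - l ^+ 2 * dot F F).
  by field; rewrite lt0r_neq0.
rewrite -subr_le0; apply: le_trans GH; rewrite le_eqVlt.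
by apply/orP; left; apply/eqP; ring.
Qed.

(** Makes the means of [F] and [G] spectral coefficients at the eigenvalue 0. *)
Lemma eigen_cst1 : eigenspace mu D L (lam 0) (cst 1).
Proof.
split; first exact/(algebra_domain HA)/(algebra_cst HA).
apply: filterS (algebra_L_cst1 HA) => x L1 _.
by rewrite -[LHS]/(- L (cst 1) x) (L1 I) (spectrum0 Hspec) /= oppr0 mul0r.
Qed.

Lemma mean_chaos : dot F (cst 1) = 0.
Proof.
apply: (eigen_coef_distinct Hspec _ eigF eigen_cst1).
by rewrite (spectrum0 Hspec) lt0r_neq0// lam_gt0.
Qed.

Lemma mean_carre_du_champ : dot G (cst 1) = l * dot F F.
Proof.
rewrite dotL2C.
rewrite (eigen_coef_iter_grad HL Hrev Hspec HA AF HF.1 1 eigen_cst1).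
rewrite expr1 (spectrum0 Hspec) mul0r subr0; congr (_ * _).
by apply: eq_Rintegral => x _; rewrite /= mul1r.
Qed.

End Chaos.

(** * The variance bound *)

Lemma variance_dotL2 {R : realType} {d : measure_display} {E : measurableType d}
    (mu : probability E R) (f : E -> R) : L2 mu f ->
  'V_mu[f]%E = (dotL2 mu f f - dotL2 mu f (cst 1) ^+ 2)%:E.
Proof.
move=> f2.
have E_dot g h : L2 mu g -> L2 mu h -> 'E_mu[g * h]%E = (dotL2 mu g h)%:E.
  move=> g2 h2; rewrite unlock /dotL2 /Rintegral fineK//.
  by apply: integrable_fin_num => //; exact: L2_mul_integrable.
rewrite varianceE// expr2 E_dot// -[X in 'E_mu[X]%E]mulr1 E_dot//.
exact: L2_cst.
Qed.

Theorem theorem10 (R : realType) (d : measure_display) (E : measurableType d)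
    (mu : probability E R)
    (D : set (E -> R)) (L : (E -> R) -> E -> R) (A : set (E -> R))
    (lam : nat -> R)
    (HL : Markov_operator mu D L)
    (Hinv : invariant mu D L)
    (Hrev : reversible mu D L)
    (HA : carre_du_champ_algebra mu D L A)
    (Herg : ergodic mu L A)
    (Hspec : pure_point_spectrum mu D L lam)
    (k : nat) (hk : (1 <= k)%N)
    (F : E -> R) (AF : A F) (HF : chaos mu L lam k F)
    (p : R) (Hp : (\int[mu]_x (F x ^+ 2) = p)%R) (p_gt0 : 0 < p)
    (HT : forall n : nat, (-1) ^+ k * (Tpoly lam k.+1).[- (lam n / 2)] <= 0) :
  ('V_mu[(carre_du_champ L F F - cst (lam k) * F)%R] <=
    (lam k * \int[mu]_x (F x ^+ 2 * carre_du_champ L F F x)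
     + Acoef lam k * \int[mu]_x (F x * carre_du_champ L F F x)
     - p * Bcoef lam k - p ^+ 2 * lam k ^+ 2)%R%:E)%E.
Proof.
set G := carre_du_champ L F F.
have AL2 f : A f -> L2 mu f.
  by move=> /(algebra_domain HA); exact: domain_L2 HL _.
have F2 : L2 mu F by exact: AL2.
have G2 : L2 mu G by apply/AL2/(algebra_iter_grad HA 1).
have lF2 : L2 mu (cst (lam k) * F) by exact: L2_scale.
have -> : \int[mu]_x (F x ^+ 2 * G x) = dotL2 mu (F * F) G.
  by apply: eq_Rintegral => x _; rewrite expr2.
rewrite -/(dotL2 mu F G).
have FFp : dotL2 mu F F = p.
  by rewrite -Hp; apply: eq_Rintegral => x _; rewrite expr2.
rewrite variance_dotL2; last exact: L2_sub.
rewrite lee_fin.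
have -> : dotL2 mu (G - cst (lam k) * F) (cst 1) = lam k * p.
  rewrite dotL2Bl//; last exact: L2_cst.
  rewrite (dotL2Zl (lam k))//; last exact: L2_cst.
  rewrite (mean_carre_du_champ HL Hrev HA Hspec AF HF) (mean_chaos HA Hspec hk AF HF).
  by rewrite mulr0 subr0 FFp.
have -> : dotL2 mu (G - cst (lam k) * F) (G - cst (lam k) * F)
    = dotL2 mu G G - 2 * lam k * dotL2 mu F G + lam k ^+ 2 * p.
  have GF2 := L2_sub G2 lF2.
  rewrite dotL2Bl// (dotL2Zl (lam k))// !(dotL2C _ _ (G - _)).
  rewrite !dotL2Bl// !(dotL2Zl (lam k))// FFp (dotL2C _ G F); ring.
have := chaos_dissipation HL Hrev HA Hspec hk AF HF HT.
rewrite -/G FFp.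
have pk0 := lt0r_neq0 (eig_prod_gt0 Hspec k.-1).
(* T_{k+1}(- l / 2) = R_{k+1}(l / 2) - R_{k+1}(l), with R_{k+1}(l) known. *)
have -> : (-1) ^+ k * (Tpoly lam k.+1).[- (lam k / 2)] / eig_prod lam k.-1 =
   1 + (-1) ^+ k * (Rpoly lam k.+1).[lam k / 2] / eig_prod lam k.-1.
  rewrite horner_Tpoly Rpoly_at_eig//; [|exact: spectrum0 Hspec|].
    have -> : - (lam k / 2) + lam k = lam k / 2 by field.
    rewrite opprK mulrDr mulrA -expr2 sqrr_sign mul1r mulrDl divff//; ring.
  exact/lt0r_neq0/(lam_gt0 Hspec).
move=> h; rewrite -subr_ge0; move: h; rewrite -subr_ge0.
move=> /le_trans; apply; rewrite le_eqVlt; apply/orP; left; apply/eqP.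
by rewrite /Acoef /Bcoef; ring.
Qed.
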